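(* Let $F$ be a finite group and let $G,H$ be finitely generated groups. Suppose there is a short exact sequence of groups $$1\to F\xrightarrow{\alpha} G\xrightarrow{\beta} H\to 1.$$ Then $G$ is polynomially full if and only if $H$ is polynomially full. In this case, $\mathcal{F}_H\leq\mathcal{F}_G$.
   Context: For a group $G$, $G^{fin}$ is the set of finite order elements. For $g\in G^{fin}$ of order $d$, $p_g=\frac{1+g+\cdots+g^{d-1}}{d}\in\mathbb{C}G$. The equivalence relation $\sim_{\mathrm{fin}}$ on $G^{fin}$: $g\sim_{\mathrm{fin}}h$ if and only if there is $\gamma\in G$ with $p_g=\gamma p_h\gamma^{-1}$. $\mathcal{F}_G:=|G^{fin}/_{\sim_{\mathrm{fin}}}|$. Fixing a word length norm $\lVert\cdot\rVert$ from a finite generating set of a finitely generated group $G$, for $h\in G$ let $C(h)$ be its conjugacy class and $n_{h,l}:=|\{g\in C(h):\lVert g\rVert=l\}|$; $C(h)$ has polynomial growth if there are $c\in\mathbb{R}_{>0}$ and $d\in\mathbb{N}$ with $n_{h,l}\leq c\cdot l^d$ for all $l\in\mathbb{N}=\{1,2,\dots\}$; $G^{pol}:=\{g\in G : C(g)\text{ has polynomial growth}\}$. A finitely generated group $G$ is polynomially full if $G^{fin}\subseteq G^{pol}$ (equivalently, every $g\in G^{fin}$ satisfies $g\sim_{\mathrm{fin}}h$ for some $h\in G^{fin}\cap G^{pol}$). *)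

(* Defs.v *)
From HB Require Import structures.
From mathcomp Require Import all_boot all_order all_algebra all_fingroup.
From mathcomp Require Import finmap complex monalg.
From mathcomp Require Import boolp classical_sets functions cardinality reals.

Set Implicit Arguments.
Unset Strict Implicit.
Unset Printing Implicit Defensive.

Import Order.TTheory GRing.Theory Num.Theory.

Local Open Scope classical_set_scope.
Local Open Scope ring_scope.

(* [{malg K[G]}] carries a ring structure only over a [monomType], whose axiom
   [unitm] no nontrivial group satisfies, hence the alias and the product. *)
Definition group_algebra (K : nzRingType) (G : groupType) := {malg K[G]}.

Section GroupAlgebra.
Variables (K : nzRingType) (G : groupType).
Implicit Types (p q r : {malg K[G]}) (x y : G).

Definition galg_one : {malg K[G]} := << (1 : K) *g (1%g : G) >>.

Definition galg_mul p q : {malg K[G]} :=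
  \sum_(x <- msupp p) \sum_(y <- msupp q) << p@_x * q@_y *g (x * y)%g >>.

Lemma galg_mulw (d1 d2 : {fset G}) p q :
  (msupp p `<=` d1)%fset -> (msupp q `<=` d2)%fset ->
  galg_mul p q =
    \sum_(x <- d1) \sum_(y <- d2) << p@_x * q@_y *g (x * y)%g >>.
Proof.
move=> le1 le2; rewrite /galg_mul (big_fset_incl _ le1) /=.
  apply/eq_bigr => x _; apply/big_fset_incl => // y _ /mcoeff_outdom ->.
  by rewrite mulr0 monalgU0.
move=> x _ /mcoeff_outdom px.
by rewrite big1 // => y _; rewrite px mul0r monalgU0.
Qed.

Lemma galg_mulUU c1 c2 x y :
  galg_mul << c1 *g x >> << c2 *g y >> = << c1 * c2 *g (x * y)%g >>.
Proof. by rewrite (galg_mulw msuppU_le msuppU_le) !big_seq_fset1 !mcoeffUU. Qed.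

Lemma galg_mulDl : left_distributive galg_mul +%R.
Proof.
move=> p q r; rewrite (galg_mulw (msuppD_le p q) (fsubset_refl _)).
rewrite [galg_mul p r](galg_mulw (fsubsetUl _ (msupp q)) (fsubset_refl _)).
rewrite [galg_mul q r](galg_mulw (fsubsetUr (msupp p) _) (fsubset_refl _)).
rewrite -big_split /=; apply/eq_bigr => x _.
rewrite -big_split /=; apply/eq_bigr => y _.
by rewrite mcoeffD mulrDl monalgUD.
Qed.

Lemma galg_mulDr : right_distributive galg_mul +%R.
Proof.
move=> r p q; rewrite (galg_mulw (fsubset_refl _) (msuppD_le p q)).
rewrite [galg_mul r p](galg_mulw (fsubset_refl _) (fsubsetUl _ (msupp q))).
rewrite [galg_mul r q](galg_mulw (fsubset_refl _) (fsubsetUr (msupp p) _)).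
rewrite -big_split /=; apply/eq_bigr => x _.
rewrite -big_split /=; apply/eq_bigr => y _.
by rewrite mcoeffD mulrDr monalgUD.
Qed.

Lemma galg_mul0p : left_zero 0 galg_mul.
Proof. by move=> p; rewrite /galg_mul msupp0 big_seq_fset0. Qed.

Lemma galg_mulp0 : right_zero 0 galg_mul.
Proof.
by move=> p; rewrite /galg_mul big1 // => x _; rewrite msupp0 big_seq_fset0.
Qed.

Lemma galg_mul_suml I (s : seq I) (f : I -> {malg K[G]}) q :
  galg_mul (\sum_(i <- s) f i) q = \sum_(i <- s) galg_mul (f i) q.
Proof.
exact: (big_morph (galg_mul^~ q) (fun _ _ => galg_mulDl _ _ _) (galg_mul0p _)).
Qed.

Lemma galg_mul_sumr I (s : seq I) (f : I -> {malg K[G]}) q :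
  galg_mul q (\sum_(i <- s) f i) = \sum_(i <- s) galg_mul q (f i).
Proof.
exact: (big_morph (galg_mul q) (fun _ _ => galg_mulDr _ _ _) (galg_mulp0 _)).
Qed.

Lemma galg_mul1p : left_id galg_one galg_mul.
Proof.
move=> p; rewrite [in LHS](monalgE p) galg_mul_sumr [RHS]monalgE.
by apply/eq_bigr => x _; rewrite galg_mulUU mul1r mul1g.
Qed.

Lemma galg_mulp1 : right_id galg_one galg_mul.
Proof.
move=> p; rewrite [in LHS](monalgE p) galg_mul_suml [RHS]monalgE.
by apply/eq_bigr => x _; rewrite galg_mulUU mulr1 mulg1.
Qed.

Lemma galg_mulA : associative galg_mul.
Proof.
move=> p q r.
have [s [a ->]] : exists s a, p = \sum_(x <- s) << a x *g x >>.
  by exists (msupp p), (mcoeff^~ p); exact: monalgE.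
have [t [b ->]] : exists s a, q = \sum_(x <- s) << a x *g x >>.
  by exists (msupp q), (mcoeff^~ q); exact: monalgE.
have [u [c ->]] : exists s a, r = \sum_(x <- s) << a x *g x >>.
  by exists (msupp r), (mcoeff^~ r); exact: monalgE.
rewrite !galg_mul_suml; apply/eq_bigr => x _.
rewrite (galg_mul_sumr t) (galg_mul_sumr t) galg_mul_suml; apply/eq_bigr => y _.
rewrite !galg_mul_sumr; apply/eq_bigr => z _.
by rewrite !galg_mulUU mulrA mulgA.
Qed.

Lemma galg_oner_neq0 : galg_one != 0.
Proof. by rewrite monalgU_eq0 oner_eq0. Qed.

HB.instance Definition _ := GRing.Lmodule.copy (group_algebra K G) {malg K[G]}.
HB.instance Definition _ := GRing.Zmodule_isNzRing.Build (group_algebra K G)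
  galg_mulA galg_mul1p galg_mulp1 galg_mulDl galg_mulDr galg_oner_neq0.

End GroupAlgebra.

Definition galg_of (K : nzRingType) (G : groupType) (g : G) :
  group_algebra K G := << (1 : K) *g g >>.

Section FiniteOrder.
Variable G : groupType.
Implicit Types g h : G.

Definition has_finite_order g : Prop :=
  exists n, (0 < n)%N && (g ^+ n == 1)%g.

Definition Gfin : set G := [set g | has_finite_order g].

(* 0 when [g] has infinite order *)
Definition elt_order g : nat :=
  if pselect (has_finite_order g) is left e then ex_minn e else 0%N.

Variable R : realType.

Definition fin_proj g : group_algebra R[i] G :=
  (elt_order g)%:R^-1 *: \sum_(k < elt_order g) galg_of R[i] (g ^+ k)%g.

Definition sim_fin g h : Prop :=
  exists x : G,
    fin_proj g = galg_of R[i] x * fin_proj h * galg_of R[i] (x^-1)%g.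

Definition sim_fin_class g : set G := [set h | Gfin h /\ sim_fin g h].

(* the quotient of [Gfin] by [sim_fin], as a set of equivalence classes *)
Definition fin_classes : set (set G) := sim_fin_class @` Gfin.

Lemma galg_ofM g h :
  galg_of R[i] (g * h)%g = galg_of R[i] g * galg_of R[i] h.
Proof. by rewrite [RHS]galg_mulUU mulr1. Qed.

Lemma galg_of1 : galg_of R[i] (1%g : G) = 1. Proof. by []. Qed.

Lemma sim_fin_refl g : sim_fin g g.
Proof. by exists 1%g; rewrite invg1 galg_of1 mul1r mulr1. Qed.

Lemma sim_fin_sym g h : sim_fin g h -> sim_fin h g.
Proof.
move=> [x E]; exists (x^-1)%g.
by rewrite E !mulrA -galg_ofM -mulrA -galg_ofM invgK mulVg galg_of1 mulr1 mul1r.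
Qed.

Lemma sim_fin_trans g h k : sim_fin g h -> sim_fin h k -> sim_fin g k.
Proof.
move=> [x Eg] [y Eh]; exists (x * y)%g.
rewrite Eg Eh invgM (galg_ofM x y) (galg_ofM (y^-1)%g).
move: (fin_proj k) (galg_of _ x) (galg_of _ y) => p a b.
by move: (galg_of _ _) (galg_of _ _) => b' a'; rewrite !mulrA.
Qed.

End FiniteOrder.

Arguments Gfin G : clear implicits.
Arguments fin_classes G R : clear implicits.

Section WordLength.
Variables (G : groupType) (S : {fset G}).
Implicit Types g h : G.

Definition is_word (w : seq G) : bool :=
  all (fun x => (x \in S) || (x^-1 \in S)%g) w.

Definition has_word (g : G) (n : nat) : Prop :=
  exists w, [/\ is_word w, size w = n & (\prod_(x <- w) x)%g = g].

Definition generates : Prop := forall g, exists n, has_word g n.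

(* 0 on elements outside the subgroup generated by [S] *)
Definition word_norm g : nat :=
  if pselect (exists n, `[< has_word g n >]) is left e then ex_minn e else 0%N.

Definition conj_class h : set G := [set g | exists x, g = (h ^ x)%g].

Definition conj_sphere h (l : nat) : set G :=
  [set g | conj_class h g /\ word_norm g = l].

Definition conj_growth h (l : nat) : nat := #|` fset_set (conj_sphere h l)|.

Lemma finite_has_word n : finite_set [set g | has_word g n].
Proof.
elim: n => [|n IHn].
  apply: (@sub_finite_set _ _ [set 1%g]) => [g [w [_ /size0nil -> <-]]|].
    by rewrite big_nil.
  exact: finite_set1.
pose A := [set x : G | (x \in S) || (x^-1 \in S)%g].
have finA : finite_set A.
  apply: (@sub_finite_set _ _ ([set` S] `|` (fun x => x^-1)%g @` [set` S])).
    by move=> x /orP[xS|xS]; [left|right; exists (x^-1)%g; rewrite ?invgK].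
  by rewrite finite_setU; split; [|apply: finite_image]; exact: finite_fset.
apply: sub_finite_set (finite_image2 (fun x g => (x * g)%g) finA IHn).
move=> g [w []]; case: w => [//|x w] /= /andP[xS wS] [sw] <-; exists x => //.
by exists (\prod_(y <- w) y)%g; rewrite ?big_cons //; exists w.
Qed.

Lemma finite_conj_sphere h l : generates -> finite_set (conj_sphere h l).
Proof.
move=> genS; apply: sub_finite_set (finite_has_word l) => g [_ <-] /=.
rewrite /word_norm; case: pselect => [e|ne].
  by case: ex_minnP => n /asboolP.
by case: ne; have [n gn] := genS g; exists n; apply/asboolP.
Qed.

Variable R : realType.

Definition poly_growth h : Prop :=
  exists (c : R) (d : nat), [/\ 0 < c, (0 < d)%N &
    forall l : nat, (0 < l)%N -> (conj_growth h l)%:R <= c * l%:R ^+ d].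

Definition Gpol : set G := [set g | poly_growth g].

Definition polynomially_full : Prop := Gfin G `<=` Gpol.

End WordLength.

Definition short_exact (F G H : groupType)
    (alpha : {multiplicative F -> G}) (beta : {multiplicative G -> H}) : Prop :=
  [/\ injective alpha, range alpha = beta @^-1` [set 1%g] &
      range beta = [set: H]].

(* Main.v *)
Require Import Defs.
From HB Require Import structures.
From mathcomp Require Import all_boot all_order all_algebra all_fingroup.
From mathcomp Require Import finmap complex monalg.
From mathcomp Require Import boolp classical_sets functions cardinality reals.

Set Implicit Arguments.
Unset Strict Implicit.
Unset Printing Implicit Defensive.

(** Everything rests on one symmetric notion. A finite correspondence between
two groups [G] and [H] is a subgroup [C] of [G * H] that projects onto both
factors with finite kernels. The graph of [beta] is one, because [ker beta] is
the image of the finite group [F], and so is its converse; hence each property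
that passes from [G] to [H] along every finite correspondence also passes back.

Polynomial growth of a conjugacy class is such a property. Growth may be
counted on balls rather than on spheres ([poly_growthP]). A finite
correspondence distorts word lengths at most affinely ([corr_ball]): lift a word
letter by letter, then correct the result by one of finitely many elements. It
also matches conjugates with conjugates, so if [C g h], then the part of the
class of [g] in a ball is covered by the part of the class of [h] in a ball of
proportional radius, each element of the latter being used at most
[#|ker|] times ([corr_poly_growth]). Finiteness of the order passes as well,
since some power of the partner has all its powers in a finite set
([corr_Gfin]). Both implications between the two fullness statements follow.

For the comparison of numbers of classes, [beta] induces an algebra morphism
[galg_map beta] between the complex group algebras, which sends [p_g] to
[p_(beta g)]: averaging the powers of an element over any period, not only over
its order, gives the same projection ([fin_projE]). Hence [beta] maps similar
elements to similar elements ([sim_fin_map]). Every element of finite order of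
[H] lifts to one of [G], so choosing lifts of representatives injects the
classes of [H] into those of [G] ([leq_fin_classes]). *)

Import Order.TTheory GRing.Theory Num.Theory.
Local Open Scope classical_set_scope.
Local Open Scope group_scope.

(** * Balls for the word length *)

Section Balls.
Variables (G : groupType) (S : {fset G}).
Implicit Types x y : G.

Definition ball n : set G := [set x | exists2 m, (m <= n)%N & has_word S x m].

Lemma sub_ball m n : (m <= n)%N -> ball m `<=` ball n.
Proof. by move=> le_mn x [k lekm wx]; exists k => //; apply: leq_trans le_mn. Qed.

Lemma has_wordM x y m n :
  has_word S x m -> has_word S y n -> has_word S (x * y) (m + n).
Proof.
move=> [v [vS <- <-]] [w [wS <- <-]]; exists (v ++ w).
by rewrite size_cat big_cat /is_word all_cat; split=> //; apply/andP.
Qed.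

Lemma ballM x y m n : ball m x -> ball n y -> ball (m + n) (x * y).
Proof.
move=> [k le_km wx] [l le_ln wy]; exists (k + l)%N; first exact: leq_add.
exact: has_wordM.
Qed.

Lemma ball0 : ball 0 = [set 1].
Proof.
apply/seteqP; split=> [x [m]|_ ->]; last first.
  by exists 0%N => //; exists [::]; rewrite big_nil.
by rewrite leqn0 => /eqP-> [w [_ /size0nil-> <-]]; rewrite big_nil.
Qed.

Lemma finite_ball n : finite_set (ball n).
Proof.
elim: n => [|n IHn]; first by rewrite ball0.
apply: (@sub_finite_set _ _ (ball n `|` [set x | has_word S x n.+1])).
  by move=> x [m]; rewrite leq_eqVlt => /orP[/eqP->|]; [right|left; exists m].
by rewrite finite_setU; split=> //; exact: finite_has_word.
Qed.

Hypothesis genS : generates S.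

Lemma ball_word_norm n : ball n = [set x | (word_norm S x <= n)%N].
Proof.
apply/seteqP; split=> x /=; rewrite /word_norm; case: pselect => [e|ne].
- case: ex_minnP => k /asboolP _ kmin [m le_mn wx].
  by apply: leq_trans le_mn; apply/kmin/asboolP.
- by case: ne; have [n' wx] := genS x; exists n'; apply/asboolP.
- by case: ex_minnP => k /asboolP wx _ le_kn; exists k.
- by case: ne; have [n' wx] := genS x; exists n'; apply/asboolP.
Qed.

Lemma finite_sub_ball (A : set G) : finite_set A -> exists n, A `<=` ball n.
Proof.
move=> finA; exists (\max_(x <- fset_set A) word_norm S x)%N => x Ax.
rewrite ball_word_norm /=.
have : x \in fset_set A by rewrite in_fset_set // inE.
by move=> xA; apply: (@leq_bigmax_seq _ _ xpredT).
Qed.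

End Balls.

(** * Growth of a conjugacy class, counted on balls *)

Lemma subset_leq_card_fset_set (T : choiceType) (A B : set T) :
  finite_set B -> A `<=` B -> (#|` fset_set A| <= #|` fset_set B|)%N.
Proof.
move=> finB AB; apply: fsubset_leq_card.
by rewrite -fset_set_sub //; apply: sub_finite_set finB.
Qed.

Lemma card_fset_setU_le (T : choiceType) (A B : set T) :
  finite_set A -> finite_set B ->
  (#|` fset_set (A `|` B)| <= #|` fset_set A| + #|` fset_set B|)%N.
Proof. by move=> finA finB; rewrite fset_setU // cardfsU leq_subr. Qed.

Lemma card_image2_le (T U V : choiceType) (f : U -> V -> T) (A : set U)
    (B : set V) (X : set T) :
  finite_set A -> finite_set B -> X `<=` [set f a b | a in A & b in B] ->
  (#|` fset_set X| <= #|` fset_set A| * #|` fset_set B|)%N.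
Proof.
move=> finA finB subX; rewrite -(size_allpairs f).
apply: uniq_leq_size; first exact: fset_uniq.
have finX : finite_set X by apply: sub_finite_set subX _; exact: finite_image2.
move=> x; rewrite in_fset_set // inE => /subX[a Aa [b Bb <-]].
by apply: allpairs_f; rewrite in_fset_set // inE.
Qed.

Section ConjBalls.
Variables (R : realType) (G : groupType) (S : {fset G}).
Hypothesis genS : generates S.

Definition conj_ball h n : set G := conj_class h `&` ball S n.

Lemma finite_conj_ball h n : finite_set (conj_ball h n).
Proof. exact/finite_setIr/finite_ball. Qed.

Lemma conj_sphere_sub_ball h l : conj_sphere S h l `<=` conj_ball h l.
Proof. by move=> x [hx <-]; split=> //; rewrite ball_word_norm //=. Qed.

Lemma conj_ballS h n :
  conj_ball h n.+1 `<=` conj_ball h n `|` conj_sphere S h n.+1.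
Proof.
move=> x [hx]; rewrite /conj_ball !ball_word_norm //= leq_eqVlt.
by case/orP=> [/eqP|]; [right|left]; split.
Qed.

(** Summing the sphere bounds up to [n] costs one degree, and a ball contains
its boundary sphere. With [n.+1] as base, the bound on balls also covers
[n = 0], which the bound on spheres leaves out, and its degree may be 0; this
makes it easier to transport. *)
Lemma poly_growthP h : poly_growth S R h <->
  exists c d, forall n, (#|` fset_set (conj_ball h n)| <= c * n.+1 ^ d)%N.
Proof.
split=> [[c [d [c_gt0 _ leS]]]|[c [d leB]]]; last first.
  (* [n.+1 <= 2 * n] for [0 < n]; the successors make the constant and the
     degree positive. *)
  exists (c * 2 ^ d.+1).+1%:R%R, d.+1; split=> // l l_gt0.
  rewrite -natrX -natrM ler_nat.
  apply: leq_trans (subset_leq_card_fset_set _ (@conj_sphere_sub_ball h l)) _.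
    exact: finite_conj_ball.
  apply: leq_trans (leB l) _; apply: leq_trans (leq_mul (leqnSn _) (leqnn _)).
  rewrite -mulnA -expnMn leq_mul2l; apply/orP; right.
  apply: leq_trans (leq_pexp2l _ (leqnSn d)) _ => //.
  by rewrite leq_exp2r // mul2n -addnn -addn1 leq_add2l.
pose k := Num.bound c; have lek l : (0 < l)%N -> (conj_growth S h l <= k * l ^ d)%N.
  move=> /leS le_l; rewrite -(ler_nat R) natrM natrX; apply: le_trans le_l _.
  by rewrite ler_wpM2r ?exprn_ge0 // ltW // archi_boundP // ltW.
(* The summand 1 is the sphere of radius 0, which holds at most the unit. *)
have leB n : (#|` fset_set (conj_ball h n)| <= 1 + n * (k * n ^ d))%N.
  elim: n => [|n IHn].
    rewrite mul0n addn0 -(cardfs1 (1 : G)) -fset_set1; apply: subset_leq_card_fset_set.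
      exact: finite_set1.
    by rewrite /conj_ball ball0; apply: subIsetr.
  apply: leq_trans (subset_leq_card_fset_set _ (@conj_ballS h n)) _.
    rewrite finite_setU; split; first exact: finite_conj_ball.
    exact: finite_conj_sphere.
  apply: leq_trans (card_fset_setU_le _ _) _; first exact: finite_conj_ball.
    exact: finite_conj_sphere.
  rewrite mulSn addnCA addnC leq_add ?lek //.
  apply: leq_trans IHn _; rewrite leq_add2l !leq_mul //.
  by case: (d) => // d'; rewrite leq_exp2r.
exists k.+1, d.+1 => n; apply: leq_trans (leB n) _.
rewrite mulSn leq_add ?expn_gt0 // mulnCA leq_mul2l expnS; apply/orP; right.
by rewrite leq_mul //; case: (d) => // d'; rewrite leq_exp2r.
Qed.

End ConjBalls.

(** * Finite correspondences between groups *)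

Section GroupMorphism.
Variables (G H : groupType) (f : {multiplicative G -> H}).

Lemma multiplicative1 : f 1 = 1.
Proof. by apply: (mulgI (f 1)); rewrite -gmulfM !mulg1. Qed.

Lemma multiplicativeV x : f x^-1 = (f x)^-1.
Proof. by symmetry; apply: mulg1_eq; rewrite -gmulfM mulgV multiplicative1. Qed.

Lemma multiplicativeX x n : f (x ^+ n) = f x ^+ n.
Proof.
elim: n => [|n IHn]; first by rewrite !expg0 multiplicative1.
by rewrite !expgS gmulfM IHn.
Qed.

End GroupMorphism.

(** Unlike a morphism with finite kernel, this notion can be turned around: the
converse of the graph of a surjection with finite kernel is again one. *)
Record finite_corr (G H : groupType) (C : G -> H -> Prop) : Prop := FiniteCorr {
  corr1 : C 1 1;
  corrM : forall x y x' y', C x y -> C x' y' -> C (x * x') (y * y');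
  corrV : forall x y, C x y -> C x^-1 y^-1;
  corr_total : forall x, exists y, C x y;
  corr_onto : forall y, exists x, C x y;
  corr_finl : finite_set [set x | C x 1];
  corr_finr : finite_set [set y | C 1 y] }.

Lemma finite_corr_sym (G H : groupType) (C : G -> H -> Prop) :
  finite_corr C -> finite_corr (fun y x => C x y).
Proof. by case=> C1 CM CV ? ? ? ?; split=> // *; [apply: CM|apply: CV]. Qed.

Lemma short_exact_corr (F : finGroupType) (G H : groupType)
    (alpha : {multiplicative F -> G}) (beta : {multiplicative G -> H}) :
  short_exact alpha beta -> finite_corr (fun x y => beta x = y).
Proof.
case=> _ kerE imE; split=> [|x _ x' _ <- <-|x _ <-|x|y||].
- exact: multiplicative1.
- exact: gmulfM.
- exact: multiplicativeV.
- by exists (beta x).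
- have : range beta y by rewrite imE.
  by case=> x _ <-; exists x.
- have -> : [set x | beta x = 1] = range alpha by rewrite kerE.
  exact/finite_image/finite_finset.
- by apply: (sub_finite_set _ (finite_set1 1)) => y /= <-; exact: multiplicative1.
Qed.

Section Correspondence.
Variables (G H : groupType) (C : G -> H -> Prop).
Hypothesis corrC : finite_corr C.

Lemma corrX x y n : C x y -> C (x ^+ n) (y ^+ n).
Proof.
move=> Cxy; elim: n => [|n IHn]; first by rewrite !expg0; exact: (corr1 corrC).
by rewrite !expgS; apply: (corrM corrC).
Qed.

Lemma corrJ x y x' y' : C x y -> C x' y' -> C (x ^ x') (y ^ y').
Proof.
by move=> Cxy Cx'; rewrite !conjgE; do ![apply: (corrM corrC)|apply: (corrV corrC)].
Qed.

(** Otherwise the powers of [y] would be pairwise distinct. *)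
Lemma finite_powers_torsion (A : set H) y :
  finite_set A -> (forall n, A (y ^+ n)) -> Gfin H y.
Proof.
move=> finA Ay; apply: contrapT => yinf; apply: infinite_nat.
have yinj : {in [set: nat] &, injective (fun n => y ^+ n)}.
  suff lt_inj m n : (m < n)%N -> y ^+ m <> y ^+ n.
    by move=> m n _ _ E; case: (ltngtP m n) => // /lt_inj; rewrite E.
  move=> lt_mn E; apply: yinf; exists (n - m)%N.
  by rewrite subn_gt0 lt_mn expgnFr ?(ltnW lt_mn) // E mulgV eqxx.
apply: card_le_finite finA; rewrite -(card_le_eql (inj_card_eq yinj)).
by apply: subset_card_le => _ [n _ <-].
Qed.

(** If [x ^+ n = 1], then every power of [y ^+ n] corresponds to 1, and only
finitely many elements do. *)
Lemma corr_Gfin x y : C x y -> Gfin G x -> Gfin H y.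
Proof.
move=> Cxy [n /andP[n_gt0 /eqP xn1]].
have : Gfin H (y ^+ n).
  apply: (finite_powers_torsion (corr_finr corrC)) => k /=.
  by have := corrX k (corrX n Cxy); rewrite xn1 expg1n.
move=> [k /andP[k_gt0 ynk1]]; exists (n * k)%N.
by rewrite muln_gt0 n_gt0 k_gt0 expgnA.
Qed.

Section Distortion.
Variables (S : {fset G}) (T : {fset H}).
Hypothesis genT : generates T.

(** The partners of the letters are finitely many, hence of bounded length, so
lifting a word letter by letter multiplies its length by a bounded factor. This
gives a single partner of [x]; any other one differs from it by a partner of 1,
and these are also of bounded length. *)
Lemma corr_ball : exists K, forall n x y,
  C x y -> ball S n x -> ball T (n * K + K) y.
Proof.
have [f Cf] := choice (corr_total corrC).
have [K1 leK1] : exists K, f @` ([set` S] `|` (fun x => x^-1) @` [set` S])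
    `<=` ball T K.
  apply: finite_sub_ball => //; apply: finite_image.
  by rewrite finite_setU; split; [|apply: finite_image]; exact: finite_fset.
have [K2 leK2] := finite_sub_ball genT (corr_finr corrC).
have word_lift w : is_word S w ->
    exists2 y, C (\prod_(x <- w) x) y & ball T (size w * K1) y.
  elim: w => [_|x w IHw /= /andP[xS /IHw[y Cy wy]]].
    by exists 1; rewrite ?big_nil ?ball0 //; exact: (corr1 corrC).
  exists (f x * y); first by rewrite big_cons; apply: (corrM corrC).
  rewrite mulSn; apply: ballM => //; apply: leK1; exists x => //.
  by case/orP: xS => xS; [left|right; exists x^-1; rewrite ?invgK].
exists (maxn K1 K2) => n x y Cxy [m le_mn [w [wS sw xE]]].
have [y' Cy' wy'] := word_lift w wS; rewrite xE in Cy'.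
(* [y = y' * (y'^-1 * y)], where the second factor is a partner of 1. *)
rewrite -(mulKVg y' y); apply: ballM.
  apply: sub_ball wy'; rewrite sw leq_mul //; exact: leq_maxl.
apply: (sub_ball (leq_maxr K1 K2)); apply: leK2 => /=.
by rewrite -(mulVg x); apply: (corrM corrC) => //; apply: (corrV corrC).
Qed.

Variable R : realType.
Hypothesis genS : generates S.

(** A conjugate [x = g ^ z] corresponds to [h ^ w] for any partner [w] of [z], and
it is determined by [h ^ w] up to the finite set [D] of partners of 1: this is
the covering [sub_DB]. *)
Lemma corr_poly_growth g h : C g h -> poly_growth T R h -> poly_growth S R g.
Proof.
move=> Cgh /poly_growthP-/(_ genT)[c [d leT]]; apply/poly_growthP => //.
have [K leK] := corr_ball; have [s Cs] := choice (corr_onto corrC).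
set D := [set x | C x 1]; have finD : finite_set D := corr_finl corrC.
exists (#|` fset_set D| * (c * K.+1 ^ d))%N, d => n.
set B := conj_ball T h (n * K + K).
have finB : finite_set B by exact: finite_conj_ball.
have sub_DB : conj_ball S g n `<=` [set u * s y | u in D & y in B].
  move=> x [[z xE] xn]; have [w Czw] := corr_total corrC z.
  have Cx : C x (h ^ w) by rewrite xE; exact: corrJ.
  exists (x * (s (h ^ w))^-1).
    rewrite /D /= -(mulgV (h ^ w)).
    by apply: (corrM corrC) => //; apply: (corrV corrC).
  exists (h ^ w); last exact: mulgVK.
  by split; [exists w | exact: leK xn].
apply: leq_trans (card_image2_le finD finB sub_DB) _.
rewrite -mulnA leq_mul2l; apply/orP; right.
apply: leq_trans (leT _) _; rewrite -mulnA -expnMn leq_mul2l; apply/orP; right.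
(* [(n * K + K).+1 <= K.+1 * n.+1] *)
case: (d) => // d'; rewrite leq_exp2r //.
by rewrite -mulSnr [(K.+1 * _)%N]mulSn (mulnC K) -add1n leq_add2r.
Qed.

End Distortion.
End Correspondence.

Lemma corr_polynomially_full (R : realType) (G H : groupType)
    (C : G -> H -> Prop) (S : {fset G}) (T : {fset H}) :
  finite_corr C -> generates S -> generates T ->
  polynomially_full S R -> polynomially_full T R.
Proof.
move=> corrC genS genT fullS y yfin; have [x Cxy] := corr_onto corrC y.
have corrC' := finite_corr_sym corrC.
apply: (corr_poly_growth corrC' genS genT Cxy).
exact/fullS/(corr_Gfin corrC' Cxy).
Qed.

(** * Functoriality of the group algebra *)

Section PushForward.
Local Open Scope ring_scope.
Variables (K : nzRingType) (G H : groupType) (phi : {multiplicative G -> H}).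
Implicit Types p q : group_algebra K G.

Definition galg_map p : group_algebra K H :=
  \sum_(x <- msupp p) << p@_x *g phi x >>.

Lemma galg_mapw (d : {fset G}) p : (msupp p `<=` d)%fset ->
  galg_map p = \sum_(x <- d) << p@_x *g phi x >>.
Proof.
move=> le_pd; apply: big_fset_incl => // x _ /mcoeff_outdom->.
exact: monalgU0.
Qed.

Lemma galg_mapD p q : galg_map (p + q) = galg_map p + galg_map q.
Proof.
rewrite (galg_mapw (msuppD_le p q)) (galg_mapw (fsubsetUl _ (msupp q))).
rewrite (galg_mapw (fsubsetUr (msupp p) _)) -big_split; apply: eq_bigr => x _.
by rewrite mcoeffD monalgUD.
Qed.

Lemma galg_map0 : galg_map 0 = 0.
Proof. by rewrite /galg_map msupp0 big_seq_fset0. Qed.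

Lemma galg_map_sum I (r : seq I) (f : I -> group_algebra K G) :
  galg_map (\sum_(i <- r) f i) = \sum_(i <- r) galg_map (f i).
Proof. exact: (big_morph galg_map galg_mapD galg_map0). Qed.

Lemma galg_mapU c x : galg_map << c *g x >> = << c *g phi x >>.
Proof. by rewrite (galg_mapw msuppU_le) big_seq_fset1 mcoeffUU. Qed.

Lemma galg_mapZ c p : galg_map (c *: p) = c *: galg_map p.
Proof.
rewrite (galg_mapw (msuppZ_le c p)) scaler_sumr; apply: eq_bigr => x _.
apply/malgP => y; rewrite !(mcoeffZ, mcoeffU).
by case: eqP; rewrite ?mulr1n ?mulr0n ?mulr0.
Qed.

Lemma galg_mapM p q : galg_map (p * q) = galg_map p * galg_map q.
Proof.
rewrite [p * q]/(galg_mul p q) /galg_mul galg_map_sum.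
rewrite [RHS]galg_mul_suml; apply: eq_bigr => x _.
rewrite galg_map_sum [RHS]galg_mul_sumr; apply: eq_bigr => y _.
by rewrite galg_mapU gmulfM galg_mulUU.
Qed.

End PushForward.

(** * The projection of an element of finite order *)

Lemma eq_scale_invn (K : numFieldType) (V : lmodType K) (u v : V) m n :
  (0 < m)%N -> (0 < n)%N -> (u *+ n = v *+ m -> m%:R^-1 *: u = n%:R^-1 *: v)%R.
Proof.
move=> m_gt0 n_gt0 E; have m_neq0 : (m%:R != 0 :> K)%R by rewrite pnatr_eq0 -lt0n.
have n_neq0 : (n%:R != 0 :> K)%R by rewrite pnatr_eq0 -lt0n.
apply: (scalerI n_neq0); rewrite scalerA mulrC -scalerA scaler_nat E.
by rewrite -scaler_nat !scalerA mulVf // mulfV.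
Qed.

Section CyclicAverage.
Local Open Scope ring_scope.
Variables (R : realType) (G : groupType).
Implicit Types g : G.

Definition power_sum g n : group_algebra R[i] G :=
  \sum_(k < n) galg_of R[i] (g ^+ k)%g.

(** Multiplication by [g] shifts the summands cyclically. *)
Lemma mul_galg_of_period g m : (g ^+ m)%g = 1%g ->
  galg_of R[i] g * power_sum g m = power_sum g m.
Proof.
case: m => [|m] gm1; first by rewrite /power_sum !big_ord0 mulr0.
rewrite /power_sum big_distrr /= [RHS]big_ord_recl [LHS]big_ord_recr /= addrC.
rewrite -galg_ofM -expgS gm1 expg0; congr (_ + _); apply: eq_bigr => k _.
by rewrite -galg_ofM -expgS.
Qed.

Lemma mul_power_sum g m n : (g ^+ m)%g = 1%g ->
  power_sum g n * power_sum g m = power_sum g m *+ n.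
Proof.
move=> gm1; rewrite {1}/power_sum mulr_suml -[n in RHS]card_ord -sumr_const.
apply: eq_bigr => k _; elim: (k : nat) => [|j IHj].
  by rewrite expg0 galg_of1 mul1r.
by rewrite expgSr galg_ofM -mulrA mul_galg_of_period.
Qed.

Lemma comm_power_sum g m n :
  power_sum g n * power_sum g m = power_sum g m * power_sum g n.
Proof.
apply: commr_sum => k _; apply: commr_sym; apply: commr_sum => j _.
by rewrite /GRing.comm -!galg_ofM -!expgnDr addnC.
Qed.

(** For two periods [m] and [n] of [g], the commuting product of the two power
sums is [n] times the first and also [m] times the second, so the two averages
agree. *)
Lemma fin_projE g n : (0 < n)%N -> (g ^+ n)%g = 1%g ->
  fin_proj R g = n%:R^-1 *: power_sum g n.
Proof.
move=> n_gt0 gn1.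
have [d_gt0 gd1] : (0 < elt_order g)%N /\ (g ^+ elt_order g)%g = 1%g.
  rewrite /elt_order; case: pselect => [e|[]]; last first.
    by exists n; rewrite n_gt0 gn1 eqxx.
  by case: ex_minnP => m /andP[? /eqP].
apply: eq_scale_invn => //.
rewrite -/(power_sum g _) -mul_power_sum // comm_power_sum.
exact: mul_power_sum.
Qed.

End CyclicAverage.

(** * Comparing the classes of elements of finite order *)

Section Functoriality.
Variables (R : realType) (G H : groupType) (phi : {multiplicative G -> H}).

(** The order of [phi g] may be a proper divisor of that of [g]; a period of [g]
is nevertheless a period of [phi g]. *)
Lemma fin_proj_map g : Gfin G g ->
  galg_map phi (fin_proj R g) = fin_proj R (phi g).
Proof.
move=> [n /andP[n_gt0 /eqP gn1]].
rewrite (fin_projE _ n_gt0 gn1) (fin_projE _ n_gt0); last first.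
  by rewrite -multiplicativeX gn1 multiplicative1.
rewrite galg_mapZ galg_map_sum; congr (_ *: _)%R; apply: eq_bigr => k _.
by rewrite galg_mapU multiplicativeX.
Qed.

Lemma sim_fin_map g h : Gfin G g -> Gfin G h ->
  sim_fin R g h -> sim_fin R (phi g) (phi h).
Proof.
move=> gfin hfin [x E]; exists (phi x).
rewrite -!fin_proj_map // E !galg_mapM.
by rewrite !galg_mapU multiplicativeV.
Qed.

End Functoriality.

Lemma sim_fin_class_eq (R : realType) (G : groupType) (g h : G) : Gfin G h ->
  (sim_fin_class R g = sim_fin_class R h) <-> sim_fin R g h.
Proof.
move=> hfin; split=> [E|gh].
  suff : sim_fin_class R g h by case.
  by rewrite E; exact: (conj hfin (sim_fin_refl R h)).
apply/seteqP; split=> k [kfin gk]; apply: (conj kfin).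
  exact: sim_fin_trans (sim_fin_sym gh) gk.
exact: sim_fin_trans gh gk.
Qed.

(** A class [c] of [H] is sent to the class of a lift of a representative of
[c]. Pushing similarities forward along [phi] shows that this is injective. *)
Lemma leq_fin_classes (R : realType) (G H : groupType)
    (phi : {multiplicative G -> H}) : Gfin H `<=` phi @` Gfin G ->
  (fin_classes H R #<= fin_classes G R)%card.
Proof.
move=> onto_fin.
have lift y : exists x, Gfin H y -> Gfin G x /\ phi x = y.
  have [/onto_fin[x xfin <-]|] := pselect (Gfin H y); first by exists x.
  by exists 1.
have [s sP] := choice lift.
have rep c : exists y, fin_classes H R c -> Gfin H y /\ sim_fin_class R y = c.
  have [[y yfin <-]|] := pselect (fin_classes H R c); first by exists y.
  by exists 1.
have [r rP] := choice rep.
pose f c := sim_fin_class R (s (r c)).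
have f_inj : {in fin_classes H R &, injective f}.
  move=> c c' /[!inE] /rP[rfin cE] /rP[rfin' c'E].
  have [sfin sE] := sP _ rfin; have [sfin' sE'] := sP _ rfin'.
  move=> /(sim_fin_class_eq _ _ sfin')/(sim_fin_map phi sfin sfin').
  by rewrite sE sE' => /(sim_fin_class_eq _ _ rfin'); rewrite cE c'E.
have f_fun : {homo f : c / fin_classes H R c >-> fin_classes G R c}.
  by move=> c /rP[/sP[sfin _] _]; exists (s (r c)).
have subf : f @` fin_classes H R `<=` fin_classes G R by move=> _ [c /f_fun ? <-].
by rewrite -(card_le_eql (inj_card_eq f_inj)); exact: subset_card_le.
Qed.

Theorem proposition5p4 (R : realType) (F : finGroupType) (G H : groupType)
    (S : {fset G}) (T : {fset H}) (genS : generates S) (genT : generates T)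
    (alpha : {multiplicative F -> G}) (beta : {multiplicative G -> H})
    (exact : short_exact alpha beta) :
  (polynomially_full S R <-> polynomially_full T R) /\
  (polynomially_full S R -> (fin_classes H R #<= fin_classes G R)%card).
Proof.
have corr := short_exact_corr exact; have corr' := finite_corr_sym corr.
split; first by split; [apply: corr_polynomially_full corr _ _
                       |apply: corr_polynomially_full corr' _ _].
move=> _; apply: (leq_fin_classes _ (phi := beta)) => y yfin.
have [x xy] := corr_onto corr y; exists x => //.
exact: corr_Gfin corr' _ _ xy yfin.
Qed.
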